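(* For any $c>0$, any $N$ and sufficiently large $K$ (where $K$ may be finite or $K=\infty$), there exists a non-empty and open subset of the problem space $\mathcal P=\mathcal P_{N,K}$ on which $$n^{\mathrm{GBS\text{-}I}}_{\mathrm{Haf}^2}\le c\,n^{\mathrm{MC}}_{\mathrm{Haf}^2}<\infty$$ holds for all $0<\epsilon,\delta<1$.
   Context: $\mathbb{N}=\{0,1,2,\dots\}$; $N\ge1$ is an integer and $K\in\mathbb{N}\cup\{\infty\}$. For $I=(i_1,\dots,i_N)\in\mathbb{N}^N$: $|I|=i_1+\cdots+i_N$, $I!=i_1!\cdots i_N!$. Sums over $0\le k\le K$ run over all $k\in\mathbb N$ when $K=\infty$. Hafnian: for a $2m\times 2m$ matrix $M$, $m\ge 1$, $\mathrm{Haf}(M)=\frac{1}{m!2^m}\sum_{\sigma\in S_{2m}}\prod_{j=1}^m M_{\sigma(2j-1),\sigma(2j)}$; the hafnian of the empty matrix is $1$. For an $N\times N$ matrix $B$ and $I\in\mathbb{N}^N$, $B_I$ is the $|I|\times|I|$ matrix obtained from $B$ by repeating the $n$-th row and the $n$-th column $i_n$ times each (deleting them if $i_n=0$). Problem space. Let $\mathcal I_k=\{I\in\mathbb{N}^N:|I|=2k\}$ and $\mathcal A=\prod_{k=0}^K\mathbb{R}_{\ge0}^{\mathcal I_k}$ with the product topology of the usual topologies, and let $\mathcal B$ be the set of symmetric $N\times N$ real matrices with all entries strictly positive and all eigenvalues strictly between $0$ and $1$. For $B\in\mathcal B$ let $\mathcal A_B\subseteq\mathcal A$ be the subspace of all $(a_I)\in\mathcal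 A$ such that $$0\ne\sum_{k=0}^K\sum_{|I|=2k}a_I\mathrm{Haf}(B_I)^2<\infty,\qquad \sum_{k=0}^K\sum_{|I|=2k}a_I^2\,I!\,\mathrm{Haf}(B_I)^2<\infty,\qquad \sum_{k_1,k_2=0}^K\ \sum_{|I|=2k_1,\,|J|=2k_2}a_Ia_J\,\mathrm{Haf}(B_{I+J})^2<\infty$$ (the finiteness conditions are automatic when $K<\infty$). The problem space is $\mathcal P=\bigcup_{B\in\mathcal B}\mathcal A_B\subseteq\mathcal A\times\mathcal B$, i.e. the set of pairs $((a_I),B)$ with $B\in\mathcal B$ and $(a_I)\in\mathcal A_B$, with the subspace topology. For $((a_I),B)\in\mathcal P$ set $$\mu=\sum_{k=0}^K\sum_{|I|=2k}a_I\mathrm{Haf}(B_I)^2,\qquad Q^{\mathrm{GBS\text{-}I}}=\frac1d\sum_{k=0}^K\sum_{|I|=2k}a_I^2\,I!\,\mathrm{Haf}(B_I)^2,\qquad Q^{\mathrm{MC}}=\sum_{k_1,k_2=0}^K\ \sum_{|I|=2k_1,\,|J|=2k_2}a_Ia_J\,\mathrm{Haf}(B_{I+J})^2,$$ where $d=\prod_{j=1}^N\sqrt{1-\lambda_j^2}$ with $\lambda_1,\dots,\lambda_N$ the eigenvalues of $B$, and for $0<\epsilon,\delta<1$ $$n^{\mathrm{GBS\text{-}I}}_{\mathrm{Haf}^2}=\frac{Q^{\mathrm{GBS\text{-}I}}-\mu^2}{\delta\epsilon^2\mu^2},\qquad n^{\mathrm{MC}}_{\mathrm{Haf}^2}=\frac{Q^{\mathrm{MC}}-\mu^2}{\delta\epsilon^2\mu^2}.$$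 These are the guaranteed sample sizes, for approximating $\mu$ with multiplicative error $\epsilon$ and failure probability $\delta$, of the importance estimator using Gaussian Boson Sampling samples and of the plain Monte Carlo estimator. *)

(* Defs.v *)
From HB Require Import structures.
From mathcomp Require Import all_boot all_order all_algebra perm.
From mathcomp Require Import all_classical all_reals all_analysis.

Set Implicit Arguments.
Unset Strict Implicit.
Unset Printing Implicit Defensive.

Import Order.TTheory GRing.Theory Num.Theory.
Import numFieldNormedType.Exports.

Local Open Scope classical_set_scope.
Local Open Scope ring_scope.

(* The bound K ranges over N with infinity added: [None] stands for infinity. *)
Definition atmostK (k : nat) (K : option nat) : bool :=
  if K is Some m then (k <= m)%N else true.

Section MultiIndices.
Variable N : nat.

Definition multi_index := {ffun 'I_N -> nat}.

Definition mweight (I : multi_index) : nat := (\sum_(n < N) I n)%N.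

Definition mfact (I : multi_index) : nat := (\prod_(n < N) (I n)`!)%N.

Definition madd (I J : multi_index) : multi_index :=
  [ffun n => (I n + J n)%N].

(* [I] belongs to one of the sets {I : |I| = 2k} with 0 <= k <= K. *)
Definition admissible (K : option nat) (I : multi_index) : bool :=
  ~~ odd (mweight I) && atmostK (mweight I)./2 K.

(* The disjoint union of these sets: summing over it is the double sum over
   k <= K and |I| = 2k, and functions on it form the product over k <= K of the
   spaces R^{I : |I| = 2k}. *)
Definition midx (K : option nat) := {I : multi_index | admissible K I}.

End MultiIndices.

Section Hafnian.
Variable R : realType.

Lemma odd_pos_subproof n (j : 'I_n./2) : (j.*2.+1 < n)%N.
Proof.
rewrite -[ltnRHS]odd_double_half; apply: (leq_trans _ (leq_addl _ _)).
by rewrite -doubleS leq_double.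
Qed.

Definition odd_pos n (j : 'I_n./2) : 'I_n := Ordinal (odd_pos_subproof j).

Definition even_pos n (j : 'I_n./2) : 'I_n :=
  Ordinal (ltnW (odd_pos_subproof j)).

(* Stated for every size so as to avoid casts; it is only used for even n = 2m,
   where m = n./2, and it is 1 for n = 0.  Positions are counted from 0. *)
Definition haf n (M : 'M[R]_n) : R :=
  ((n./2)`! * 2 ^ n./2)%:R^-1 *
  \sum_(s : 'S_n) \prod_(j < n./2) M (s (even_pos j)) (s (odd_pos j)).

(* The matrix B_I: the (i, j) block is the I i x I j matrix constantly equal
   to B i j. *)
Definition repeat_mx N (B : 'M[R]_N) (I : multi_index N) : 'M[R]_(mweight I) :=
  \mxblock_(i < N, j < N) (const_mx (B i j) : 'M[R]_(I i, I j)).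

Definition hafI N (B : 'M[R]_N) (I : multi_index N) : R := haf (repeat_mx B I).

End Hafnian.

Section ProblemSpace.
Variables (R : realType) (N : nat) (K : option nat).

Definition coeff := {ptws midx N K -> R}.

Implicit Types (a : coeff) (B : 'M[R]_N).

Definition calA : set coeff := [set a | forall I, 0 <= a I].

Definition calB : set 'M[R]_N :=
  [set B | [/\ B^T = B,
               forall i j, 0 < B i j &
               forall l : R, eigenvalue B l -> 0 < l < 1]].

Definition mu a B : \bar R :=
  \esum_(I in [set: midx N K]) (a I * hafI B (val I) ^+ 2)%:E.

Definition sumGBS a B : \bar R :=
  \esum_(I in [set: midx N K])
    (a I ^+ 2 * (mfact (val I))%:R * hafI B (val I) ^+ 2)%:E.

Definition QMC a B : \bar R :=
  \esum_(p in [set: midx N K * midx N K])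
    (a p.1 * a p.2 * hafI B (madd (val p.1) (val p.2)) ^+ 2)%:E.

Definition calA_ B : set coeff :=
  [set a | calA a /\
    [/\ (mu a B != 0)%E, (mu a B < +oo)%E,
        (sumGBS a B < +oo)%E & (QMC a B < +oo)%E]].

Definition problem_space : set (coeff * 'M[R]_N) :=
  [set x | calB x.2 /\ calA_ x.2 x.1].

Definition open_in_problem_space (U : set (coeff * 'M[R]_N)) : Prop :=
  U `<=` problem_space /\ open (U : set (subspace problem_space)).

(* The product over all eigenvalues counted with multiplicity, as a product over
   the distinct eigenvalues. *)
Definition dGBS B : R :=
  \big[*%R/1]_(l \in [set l : R | eigenvalue B l])
    Num.sqrt (1 - l ^+ 2) ^+ mup l (char_poly B).

Definition QGBS a B : \bar R := ((dGBS B)^-1%:E * sumGBS a B)%E.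

Definition sample_size (Q m : \bar R) (eps delta : R) : \bar R :=
  ((Q - m ^+ 2) / ((delta * eps ^+ 2)%:E * m ^+ 2))%E.

Definition nGBS a B (eps delta : R) : \bar R :=
  sample_size (QGBS a B) (mu a B) eps delta.

Definition nMC a B (eps delta : R) : \bar R :=
  sample_size (QMC a B) (mu a B) eps delta.

End ProblemSpace.

(* Main.v *)
(* Write h_I = Haf(B_I).  Counting letters in words of pairs, h_I is the
   coefficient I! [z^I] exp(z^T B z / 2).  Differentiating this generating
   function gives Isserlis' recursion, which yields h_I h_J <= h_(I+J) and
   h_(2I) >= prod_n B_nn^(I_n) (2 I_n - 1)!!, while evaluating it at
   z_n = sqrt(I_n) gives h_I^2 <= 2^N I! (3r/2)^|I| whenever z^T B z <= r |z|^2.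
   For B close to (17/20) Id one may take r = 9/10, and then I! h_I^2 and h_I^4
   are exponentially smaller than h_(2I)^2 as |I| grows.

   All terms a_I a_J (h_(I+J)^2 - h_I^2 h_J^2) of Q^MC - mu^2 are nonnegative, and
   for |I| >= 2 m0 the diagonal one dominates the corresponding term of Q^GBS,
   whatever the value of a_I.  So no control of the tail of (a_I) is needed,
   which matters for K infinite, where open sets constrain finitely many
   coordinates.  The terms of Q^GBS with |I| < 2 m0 are paid for by the surplus of
   the diagonal term of one index I0 with |I0| = 2 m0: it suffices that a_I0 > 1
   and that the finitely many a_I with |I| < 2 m0 are small. *)
Require Import Defs.
From mathcomp Require Import all_boot all_order all_algebra perm.
From mathcomp Require Import all_classical all_reals all_analysis.
From mathcomp Require Import finmap ring lra zify.

Set Implicit Arguments.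
Unset Strict Implicit.
Unset Printing Implicit Defensive.

Import Order.TTheory GRing.Theory Num.Theory.
Import numFieldNormedType.Exports.

Local Open Scope classical_set_scope.
Local Open Scope ring_scope.

(** * Multi-indices and weighted sums over words *)

Section MultiIndexTheory.
Variable N : nat.
Implicit Types (I J L : multi_index N) (n k : 'I_N).

Definition mindex0 : multi_index N := [ffun=> 0%N].
Definition munit n : multi_index N := [ffun k => (k == n : nat)].
(** The subtraction is truncated: for [I n = 0] the value is [I] itself. In the recursions such
    terms carry the factor [I n] and vanish. *)
Definition mpred n I : multi_index N := [ffun k => (I k - (k == n))%N].

Lemma maddE I J n : madd I J n = (I n + J n)%N. Proof. exact: ffunE. Qed.

Lemma maddC : commutative (@madd N).
Proof. by move=> I J; apply/ffunP=> k; rewrite !ffunE addnC. Qed.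

Lemma maddA : associative (@madd N).
Proof. by move=> I J L; apply/ffunP=> k; rewrite !ffunE addnA. Qed.

Lemma maddAC : right_commutative (@madd N).
Proof. by move=> I J L; rewrite -!maddA (maddC J). Qed.

Lemma madd0 I : madd I mindex0 = I.
Proof. by apply/ffunP=> k; rewrite !ffunE addn0. Qed.

Lemma maddK n I : mpred n (madd I (munit n)) = I.
Proof. by apply/ffunP=> k; rewrite !ffunE addnK. Qed.

Lemma mpredK n I : (0 < I n)%N -> madd (mpred n I) (munit n) = I.
Proof.
move=> In; apply/ffunP=> k; rewrite !ffunE subnK //.
by case: eqP => // ->.
Qed.

Lemma mpredD n I J : (0 < I n)%N -> mpred n (madd I J) = madd (mpred n I) J.
Proof. by move=> In; rewrite -{1}(mpredK In) maddAC maddK. Qed.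

Lemma madd_munit_eq n I J :
  (madd J (munit n) == I) = (0 < I n)%N && (J == mpred n I).
Proof.
apply/eqP/andP => [<-|[In /eqP->]]; last by rewrite mpredK.
by rewrite maddK !ffunE !eqxx addn1.
Qed.

Lemma mfactD1 n I : mfact (madd I (munit n)) = ((I n).+1 * mfact I)%N.
Proof.
rewrite /mfact (bigD1 n) //= [in RHS](bigD1 n) //= mulnA !ffunE eqxx addn1.
congr (_ * _)%N; apply: eq_bigr => k /negPf kn.
by rewrite !ffunE kn addn0.
Qed.

Lemma mweightD I J : mweight (madd I J) = (mweight I + mweight J)%N.
Proof. by rewrite /mweight -big_split; apply: eq_bigr => k _; rewrite ffunE. Qed.

Lemma mweight_munit n : mweight (munit n) = 1%N.
Proof.
rewrite /mweight (bigD1 n) //= big1 ?ffunE ?eqxx // => k /negPf kn.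
by rewrite ffunE kn.
Qed.

Lemma mweight0 I : (mweight I == 0%N) = (I == mindex0).
Proof.
rewrite /mweight sum_nat_eq0; apply/forallP/eqP => [I0|-> k]; last by rewrite ffunE.
by apply/ffunP=> k; rewrite ffunE; apply/eqP/I0.
Qed.

Lemma mweight_gt0 I : (0 < mweight I)%N -> exists n, (0 < I n)%N.
Proof.
rewrite lt0n /mweight sum_nat_eq0 negb_forall => /existsP[n In].
by exists n; rewrite lt0n.
Qed.

Lemma mfact_gt0 I : (0 < mfact I)%N.
Proof. by apply: prodn_gt0 => k; exact: fact_gt0. Qed.

Lemma mindex_ind (P : multi_index N -> Prop) :
  P mindex0 -> (forall I n, P I -> P (madd I (munit n))) -> forall I, P I.
Proof.
move=> P0 PS I; have [m] := ubnP (mweight I); elim: m I => // m IH I Im.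
have [|/mweight_gt0[n In]] := posnP (mweight I).
  by move/eqP; rewrite mweight0 => /eqP->.
rewrite -(mpredK In); apply/PS/IH; move: Im.
by rewrite -{1}(mpredK In) mweightD mweight_munit addn1.
Qed.

End MultiIndexTheory.
Arguments mindex0 {N}.

(** * Coefficients of the powers of z^T B z and their recursions *)

Section WordSums.
Variables (R : realFieldType) (N : nat) (B : 'M[R]_N).
Implicit Types (I J L : multi_index N) (F G : multi_index N -> R).

(* The sum of B p_1 q_1 * ... * B p_m q_m * F I over the words
   (p_1, q_1) ... (p_m, q_m), where I counts the occurrences of each letter.
   So [wsum m (fun J => (J == I)%:R)] is the coefficient of z^I in
   (z^T B z)^m. *)
Fixpoint wsum m F : R :=
  if m is m'.+1 then
    \sum_p \sum_q B p q * wsum m' (fun I => F (madd I (madd (munit p) (munit q))))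
  else F mindex0.

Arguments wsum : simpl never.

Lemma wsumS m F : wsum m.+1 F =
  \sum_p \sum_q B p q * wsum m (fun I => F (madd I (madd (munit p) (munit q)))).
Proof. by []. Qed.

Lemma eq_wsum m F G : F =1 G -> wsum m F = wsum m G.
Proof.
elim: m F G => [|m IH] F G FG; first exact: FG.
rewrite !wsumS.
by apply: eq_bigr => p _; apply: eq_bigr => q _; congr (_ * _); apply: IH.
Qed.

Lemma wsumZ m a F : wsum m (fun I => a * F I) = a * wsum m F.
Proof.
elim: m F => [|m IH] F; first by [].
rewrite !wsumS.
rewrite big_distrr; apply: eq_bigr => p _; rewrite big_distrr.
by apply: eq_bigr => q _; rewrite IH mulrCA.
Qed.

Lemma wsumD m F G : wsum m (fun I => F I + G I) = wsum m F + wsum m G.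
Proof.
elim: m F G => [|m IH] F G; first by [].
rewrite !wsumS.
rewrite -big_split; apply: eq_bigr => p _; rewrite -big_split.
by apply: eq_bigr => q _; rewrite IH mulrDr.
Qed.

Lemma le_wsum m F G : (forall p q, 0 <= B p q) -> (forall I, F I <= G I) ->
  wsum m F <= wsum m G.
Proof.
move=> B0; elim: m F G => [|m IH] F G FG; first exact: FG.
rewrite !wsumS.
apply: ler_sum => p _; apply: ler_sum => q _.
by apply: ler_wpM2l => //; apply: IH.
Qed.

(* The identity d(Q^m)/dz_n = 2m (B z)_n Q^(m-1) for Q = z^T B z. *)
Lemma wsum_derive m n F : B^T = B ->
  wsum m.+1 (fun J => (J n)%:R * F J) =
  (m.+1.*2)%:R *
    \sum_k B n k * wsum m (fun J => F (madd J (madd (munit n) (munit k)))).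
Proof.
move=> BT; have Bsym p q : B p q = B q p by rewrite -{1}BT mxE.
(* Derivative of one factor z^T B z: both positions of the pair contribute equally because B is
   symmetric. *)
have delta2 G :
    \sum_p \sum_q B p q * ((p == n)%:R + (q == n)%:R) * G (madd (munit p) (munit q))
    = 2 * \sum_k B n k * G (madd (munit n) (munit k)).
  have half : \sum_p \sum_q B p q * (p == n)%:R * G (madd (munit p) (munit q))
    = \sum_k B n k * G (madd (munit n) (munit k)).
    rewrite (bigD1 n) //= [X in _ + X]big1 ?addr0 => [|p /negPf pn].
      by apply: eq_bigr => k _; rewrite eqxx mulr1.
    by rewrite big1 // => q _; rewrite pn mulr0 mul0r.
  have half' : \sum_p \sum_q B p q * (q == n)%:R * G (madd (munit p) (munit q))
    = \sum_k B n k * G (madd (munit n) (munit k)).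
    rewrite exchange_big -half; apply: eq_bigr => p _; apply: eq_bigr => q _.
    by rewrite Bsym maddC.
  rewrite mulr_natl mulr2n -{1}half -half' -big_split; apply: eq_bigr => p _.
  by rewrite -big_split; apply: eq_bigr => q _; rewrite mulrDr mulrDl.
elim: m F => [|m IH] F.
  rewrite -[(1.*2)%:R]/(2 : R) wsumS -(delta2 (fun L => F (madd mindex0 L))).
  apply: eq_bigr => p _; apply: eq_bigr => q _.
  by rewrite /wsum !ffunE add0n natrD mulrA ![n == _]eq_sym.
have exch a (w : 'I_N -> 'I_N -> 'I_N -> R) :
    \sum_p \sum_q B p q * (a * \sum_k B n k * w p q k) =
    a * \sum_k B n k * \sum_p \sum_q B p q * w p q k.
  under eq_bigr do under eq_bigr do rewrite mulrCA mulr_sumr.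
  under eq_bigr do rewrite -mulr_sumr exchange_big /=.
  rewrite -mulr_sumr exchange_big /=; congr (_ * _); apply: eq_bigr => k _.
  rewrite mulr_sumr; apply: eq_bigr => p _; rewrite mulr_sumr.
  by apply: eq_bigr => q _; rewrite mulrCA.
have ->: (m.+2.*2)%:R = (m.+1.*2)%:R + 2 :> R by rewrite -natrD addn2.
move: (m.+1.*2%:R : R) IH => d IH.
(* Product rule: the occurrences of n are those in the remaining m + 1 pairs, handled by the
   induction hypothesis, plus those in the pair (p, q), handled by [delta2]. *)
rewrite wsumS; transitivity (\sum_p \sum_q (B p q * (d * \sum_k B n k *
      wsum m (fun J => F (madd (madd J (madd (munit n) (munit k))) (madd (munit p) (munit q)))))
    + B p q * ((p == n)%:R + (q == n)%:R) *
      wsum m.+1 (fun J => F (madd J (madd (munit p) (munit q)))))).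
  apply: eq_bigr => p _; apply: eq_bigr => q _.
  rewrite -mulrA -mulrDr; congr (_ * _).
  rewrite -(IH (fun J => F (madd J (madd (munit p) (munit q))))) -wsumZ -wsumD.
  by apply: eq_wsum => J; rewrite !ffunE !natrD mulrDl ![n == _]eq_sym.
under eq_bigr do rewrite big_split /=; rewrite big_split /= exch.
rewrite (delta2 (fun L => wsum m.+1 (fun J => F (madd J L)))).
rewrite (mulrDl d); congr (_ + _).
congr (_ * _); apply: eq_bigr => k _; congr (_ * _).
apply: eq_bigr => p _; apply: eq_bigr => q _; congr (_ * _).
by apply: eq_wsum => J; rewrite maddAC.
Qed.

(** By [sum_perm_pairs] below, this is the sum over permutations in the hafnian, before division by
    m! 2^m. *)
Definition hf m I : R := (mfact I)%:R * wsum m (fun J => (J == I)%:R).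

Lemma mfact_shift n I J :
  (mfact I)%:R * (madd J (munit n) == I)%:R =
  (I n)%:R * ((mfact (mpred n I))%:R * (J == mpred n I)%:R) :> R.
Proof.
rewrite madd_munit_eq; have [->|In] := posnP (I n); first by rewrite mulr0 mul0r.
rewrite /= mulrA; congr (_ * _); rewrite -natrM; congr (_%:R).
by rewrite -{1}(mpredK In) mfactD1 -{3}(mpredK In) !ffunE eqxx addn1.
Qed.

(** The first pair (p, q) of a word is removed; the factors count the choices, without replacement,
    of a copy of p and then of a copy of q. *)
Lemma hfS m I : hf m.+1 I =
  \sum_p (I p)%:R * \sum_q ((mpred p I) q)%:R * (B p q * hf m (mpred q (mpred p I))).
Proof.
rewrite /hf wsumS mulr_sumr; apply: eq_bigr => p _.
rewrite !mulr_sumr; apply: eq_bigr => q _.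
rewrite (mulrCA _ (B p q)) (mulrCA ((mpred p I) q)%:R (B p q)) (mulrCA (I p)%:R).
congr (_ * _); rewrite -!wsumZ; apply: eq_wsum => J.
by rewrite maddA maddAC mfact_shift mfact_shift.
Qed.

(** For |I| = 2m this is I! [z^I] exp(z^T B z / 2), and otherwise it is 0. Keeping m separate from I
    avoids halving |I| in inductions. *)
Definition nhaf m I : R := hf m I / (m`! * 2 ^ m)%:R.

Lemma nhaf0 I : nhaf 0 I = (I == mindex0)%:R.
Proof.
rewrite /nhaf /hf /wsum eq_sym fact0 expn0 divr1.
by case: eqP => [->|_]; rewrite ?mulr0 // mulr1 /mfact big1 // => k _; rewrite ffunE.
Qed.

Lemma nhafS0 m : nhaf m.+1 mindex0 = 0.
Proof. by rewrite /nhaf hfS big1 ?mul0r // => p _; rewrite ffunE mul0r. Qed.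

(* Expansion along a row of colour n; for moments of a centered Gaussian vector
   this is Isserlis' recursion. *)
Lemma nhaf_rec m n I : B^T = B ->
  nhaf m.+1 (madd I (munit n)) =
  \sum_k B n k * ((I k)%:R * nhaf m (mpred k I)).
Proof.
move=> BT; set e := munit n.
(* The coefficient of z^I in the derivative of (z^T B z)^(m + 1) along z_n, computed in two ways. *)
have key : (I n).+1%:R * wsum m.+1 (fun J => (J == madd I e)%:R) =
    (m.+1.*2)%:R * \sum_k B n k * wsum m (fun J => (madd J (munit k) == I)%:R).
  rewrite -wsumZ (@eq_wsum _ _ (fun J => (J n)%:R * (J == madd I e)%:R)); last first.
    move=> J; have [->|_] := eqVneq J (madd I e); last by rewrite !mulr0.
    by rewrite !ffunE eqxx addn1.
  rewrite wsum_derive //; congr (_ * _); apply: eq_bigr => k _; congr (_ * _).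
  apply: eq_wsum => J; congr (_%:R).
  rewrite (maddC e) maddA; congr (nat_of_bool _).
  by apply/eqP/eqP => [/(congr1 (mpred n))|->]; rewrite ?maddK.
have -> : nhaf m.+1 (madd I e) = (mfact I)%:R *
    ((I n).+1%:R * wsum m.+1 (fun J => (J == madd I e)%:R)) / (m.+1`! * 2 ^ m.+1)%:R.
  by rewrite /nhaf /hf mfactD1 natrM -mulrA (mulrCA (mfact I)%:R) -!mulrA.
rewrite key (_ : m.+1`! * 2 ^ m.+1 = m.+1.*2 * (m`! * 2 ^ m))%N; last first.
  by rewrite factS expnS -muln2; ring.
rewrite /nhaf; move: (m`! * 2 ^ m)%N => D; rewrite natrM invfM.
have cancel (x y z w : R) : x != 0 -> y * (x * z) * (x^-1 * w) = y * z * w.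
  by move=> x0; field.
rewrite cancel ?pnatr_eq0 // mulr_sumr mulr_suml; apply: eq_bigr => k _.
rewrite mulrCA -!mulrA; congr (_ * _); rewrite /hf !mulrA; congr (_ / _).
rewrite -mulrA -!wsumZ; apply: eq_wsum => J; exact: mfact_shift.
Qed.

Hypothesis BT : B^T = B.
Hypothesis B_ge0 : forall p q, 0 <= B p q.

Lemma nhaf_ge0 m I : 0 <= nhaf m I.
Proof.
elim: m I => [|m IH] I; first by rewrite nhaf0.
case: (posnP (mweight I)) => [/eqP|/mweight_gt0[n In]].
  by rewrite mweight0 => /eqP->; rewrite nhafS0.
rewrite -(mpredK In) nhaf_rec //; apply: sumr_ge0 => k _.
by rewrite mulr_ge0 // mulr_ge0.
Qed.

(** Among the perfect matchings of I + J are those joining no letter of I to a letter of J. In the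
    recursion along a letter of I, the nonnegative terms taking the partner from J are dropped. *)
Lemma nhaf_supmul m l I J : nhaf m I * nhaf l J <= nhaf (m + l) (madd I J).
Proof.
elim: m I => [|m IH] I.
  rewrite nhaf0; have [->|_] := eqVneq; last by rewrite mul0r nhaf_ge0.
  by rewrite mul1r maddC madd0.
case: (posnP (mweight I)) => [/eqP|/mweight_gt0[n In]].
  by rewrite mweight0 => /eqP->; rewrite nhafS0 mul0r nhaf_ge0.
rewrite -(mpredK In); set I' := mpred n I.
rewrite maddAC addSn !nhaf_rec // mulr_suml; apply: ler_sum => k _.
rewrite -mulrA ler_wpM2l // -mulrA maddE natrD mulrDl.
have [->|Ik] := posnP (I' k); first by rewrite !mul0r add0r mulr_ge0 ?nhaf_ge0.
rewrite mpredD // -[leLHS]addr0 lerD //; last by rewrite mulr_ge0 ?nhaf_ge0.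
by apply: ler_wpM2l => //; exact: IH.
Qed.

(** Only matchings of equal letters are kept: 2 I_n copies of n have (2 I_n - 1)!! of them, each of
    weight B_nn^(I_n). In the recursion, only the term k = n survives. *)
Lemma nhaf_square_ge I :
  \prod_n (B n n ^+ I n * (\prod_(j < I n) j.*2.+1)%:R) <=
  nhaf (mweight I) (madd I I).
Proof.
elim/mindex_ind: I => [|I n IH].
  rewrite madd0 (_ : mweight mindex0 = 0)%N; last by apply/eqP; rewrite mweight0.
  rewrite nhaf0 eqxx big1 // => k _; by rewrite ffunE expr0 big_ord0 mulr1.
rewrite mweightD mweight_munit addn1.
have -> : madd (madd I (munit n)) (madd I (munit n)) = madd (madd (madd I I) (munit n)) (munit n).
  by rewrite maddA (maddAC I _ I).
rewrite nhaf_rec // [leRHS](bigD1 n) //=.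
rewrite -[leLHS]addr0; apply: lerD; last first.
  by apply: sumr_ge0 => k _; apply: mulr_ge0 => //; apply: mulr_ge0 => //; exact: nhaf_ge0.
rewrite maddK !ffunE eqxx addn1 addnn.
have -> : \prod_k (B k k ^+ madd I (munit n) k * (\prod_(j < madd I (munit n) k) j.*2.+1)%:R) =
  B n n * ((I n).*2.+1%:R * \prod_k (B k k ^+ I k * (\prod_(j < I k) j.*2.+1)%:R)) :> R.
  rewrite (bigD1 n) //= [in RHS](bigD1 n) //= !ffunE eqxx addn1 exprS big_ord_recr natrM /=.
  rewrite -!mulrA; congr (_ * _); rewrite !mulrA; congr (_ * _); first by ring.
  by apply: eq_bigr => k /negPf kn; rewrite !ffunE kn addn0.
by rewrite ler_wpM2l // ler_wpM2l.
Qed.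

End WordSums.

(** * Hafnians as sums over words *)

(** A permutation is determined by the image of 0 and the permutation it induces on the rest;
    injectivity and the count (n + 1)! = (n + 1) n! give the bijection. *)
Lemma sum_perm_lift (V : nmodType) n (F : 'S_n.+1 -> V) :
  \sum_s F s = \sum_i \sum_(s : 'S_n) F (lift_perm ord0 i s).
Proof.
rewrite pair_big /=.
have inj : injective (fun p : 'I_n.+1 * 'S_n => lift_perm ord0 p.1 p.2).
  move=> [i s] [j t] /= st.
  have ij : i = j by rewrite -(lift_perm_id ord0 i s) st lift_perm_id.
  subst j; congr (_, _); apply/permP => k; apply: (@lift_inj _ i).
  by rewrite -!(lift_perm_lift ord0) st.
rewrite (reindex (fun p : 'I_n.+1 * 'S_n => lift_perm ord0 p.1 p.2)) //.
apply/onW_bij/(inj_card_bij inj).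
by rewrite card_prod !card_Sn card_ord factS.
Qed.

Section HafnianWords.
Variable N : nat.
Implicit Types (I J : multi_index N).

Definition content n (c : 'I_n -> 'I_N) : multi_index N :=
  [ffun k => (\sum_i (c i == k))%N].

Lemma content_lift n (c : 'I_n.+1 -> 'I_N) i :
  content (c \o lift i) = mpred (c i) (content c).
Proof.
apply/ffunP => k; rewrite !ffunE (bigD1_ord i) //= eq_sym addKn.
by [].
Qed.

Lemma sum_content (V : nzSemiRingType) n (c : 'I_n -> 'I_N) (G : 'I_N -> V) :
  \sum_i G (c i) = \sum_p (content c p)%:R * G p.
Proof.
under [RHS]eq_bigr do rewrite ffunE natr_sum mulr_suml.
rewrite exchange_big; apply: eq_bigr => i _ /=.
rewrite (bigD1 (c i)) //= eqxx mul1r big1 ?addr0 // => k /negPf kc.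
by rewrite eq_sym kc mul0r.
Qed.

Lemma pair_pos_subproof m (b : bool) (j : 'I_m) : (b + j.*2 < m.*2)%N.
Proof. by have := ltn_ord j; case: b; lia. Qed.

(** The positions 2j and 2j + 1, indexed by ['I_m] so that induction on m meets no halving. *)
Definition pair_pos m b (j : 'I_m) : 'I_(m.*2) := Ordinal (pair_pos_subproof b j).

Variables (R : realType) (B : 'M[R]_N).

(** Induction on m by the images i and i' of the first two positions: deleting their colours from c
    is exactly the step of [hfS]. *)
Lemma sum_perm_pairs m (c : 'I_(m.*2) -> 'I_N) :
  \sum_(s : 'S_(m.*2)) \prod_(j < m)
    B (c (s (pair_pos false j))) (c (s (pair_pos true j))) =
  hf B m (content c).
Proof.
elim: m c => [|m IH] c.
  under eq_bigr do rewrite big_ord0.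
  rewrite sumr_const cardT -cardE card_Sn fact0 /hf /wsum.
  have -> : content c = mindex0 by apply/ffunP => k; rewrite !ffunE big_ord0.
  by rewrite eqxx mulr1 /mfact big1 // => k _; rewrite ffunE.
rewrite hfS -(sum_content c (fun p => \sum_q (mpred p (content c) q)%:R *
  (B p q * hf B m (mpred q (mpred p (content c)))))).
rewrite (@sum_perm_lift _ m.*2.+1); apply: eq_bigr => i _.
rewrite -content_lift -sum_content sum_perm_lift; apply: eq_bigr => i' _ /=.
rewrite -content_lift -IH mulr_sumr; apply: eq_bigr => s _.
have pos0 : pair_pos false (@ord0 m) = ord0 :> 'I_(m.*2.+2) by apply: val_inj.
have pos1 : pair_pos true (@ord0 m) = lift ord0 ord0 :> 'I_(m.*2.+2) by apply: val_inj.
have posS b (j : 'I_m) :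
    pair_pos b (lift ord0 j) = lift ord0 (lift ord0 (pair_pos b j)) :> 'I_(m.*2.+2).
  by apply: val_inj; rewrite /= /bump /=; lia.
rewrite big_ord_recl pos0 pos1 lift_perm_lift !lift_perm_id; congr (_ * _).
by apply: eq_bigr => j _; rewrite !posS !lift_perm_lift.
Qed.

Lemma haf_hf n m (c : 'I_n -> 'I_N) : n = m.*2 ->
  haf (\matrix_(i, j) B (c i) (c j)) = nhaf B m (content c).
Proof.
move=> nm; subst n; rewrite /haf /nhaf -sum_perm_pairs mulrC.
have m2 := doubleK m; congr (_ / _); last by rewrite m2.
apply: eq_bigr => s _.
rewrite (reindex (cast_ord (esym m2))) /=; last first.
  by apply/onW_bij; exists (cast_ord m2) => j; rewrite ?cast_ordK ?cast_ordKV.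
apply: eq_bigr => j _; rewrite mxE.
by congr (B (c (s _)) (c (s _))); apply: val_inj.
Qed.

Lemma hafI_nhaf I m : mweight I = m.*2 -> hafI B I = nhaf B m I.
Proof.
(* B_I comes from the colouring that sends each position to the number of its block, and block k has
   [I k] positions. *)
have content_sig1 : content (@tagnat.sig1 N I) = I.
  apply/ffunP => k; rewrite ffunE.
  rewrite (reindex (@tagnat.rank N I)) /=; last exact: onW_bij tagnat.rank_bij.
  under eq_bigr do rewrite /tagnat.sig1 tagnat.rankK.
  rewrite -(sig_big_dep (fun=> true) (fun _ _ => true)
    (fun i (_ : 'I_(I i)) => nat_of_bool (i == k))) /=.
  rewrite (bigD1 k) //= [X in (_ + X)%N]big1 => [|i /negPf ik].
    by rewrite eqxx sum1_card card_ord addn0.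
  by rewrite big1 // => j _; rewrite ik.
move=> Im; rewrite -[in RHS]content_sig1 -haf_hf //; congr haf.
by apply/matrixP => i j; rewrite !mxE.
Qed.

End HafnianWords.

(** * Bounds on hafnians *)

(** The induction needs 2 n^n <= (n + 1)^n, which is Bernoulli's inequality for (1 + 1/n)^n. *)
Lemma fact_exp2_le i : (i`! * 2 ^ i <= 2 * i ^ i)%N.
Proof.
elim: i => // -[|i] IH //.
have bernoulli n : (i.+1 ^ n * (i.+1 + n) <= i.+2 ^ n * i.+1)%N.
  elim: n => [|n IHn]; first by rewrite !expn0 !mul1n addn0.
  have : (i.+1 ^ n.+1 * (i.+1 + n.+1) <= i.+2 * (i.+1 ^ n * (i.+1 + n)))%N.
    by rewrite expnS; move: (i.+1 ^ n)%N => a; nia.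
  move=> /leq_trans; apply; rewrite [(i.+2 ^ n.+1)%N]expnS -mulnA.
  by rewrite leq_mul2l IHn.
have := bernoulli i.+1; rewrite addnn -mul2n mulnA leq_mul2r /= => le2.
rewrite factS [(2 ^ _)%N]expnS [(i.+2 ^ _)%N]expnS.
have : (i.+2 * 2 * (i.+1`! * 2 ^ i.+1) <= i.+2 * 2 * (2 * i.+1 ^ i.+1))%N.
  by rewrite leq_mul2l IH.
move: le2; move: (i.+1 ^ _)%N (i.+2 ^ _)%N (2 ^ _)%N (i.+1 `!) => a b d e.
by nia.
Qed.

(** The ratio (2i + 1) / (i + 1) of successive terms reaches 7/4 at i = 3; the factor 3 absorbs the
    smaller cases. *)
Lemma odd_prod_ge i : (i`! * 7 ^ i <= 3 * (\prod_(j < i) j.*2.+1) * 4 ^ i)%N.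
Proof.
elim: i => [|i IH]; first by rewrite big_ord0.
have [i3|i3] := leqP 3 i; last first.
  by case: i i3 {IH} => [|[|[|]]] // _; rewrite !big_ord_recr big_ord0.
rewrite factS big_ord_recr /= !expnS.
move: IH; move: (7 ^ _)%N (i`!) (4 ^ _)%N (\prod_(j < i) _)%N => a b d e.
by nia.
Qed.

(** The single term m^m / m! of the exponential series is at most e^m. *)
Lemma exp_le_fact3 (R : realType) m : (m%:R ^+ m : R) <= 3 ^+ m * m`!%:R.
Proof.
case: m => [|m]; first by rewrite !expr0 mul1r.
(* From exp(-1/6) >= 5/6 follows e <= (6/5)^6 < 3. *)
have e3 : expR 1 <= 3 :> R.
  have e6 : expR (6^-1 : R) <= 6 / 5.
    have := expR_ge1Dx (- 6^-1 : R); rewrite expRN => le6.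
    have e0 := expR_gt0 (6^-1 : R).
    have : expR 6^-1 * (1 + - 6^-1) <= expR 6^-1 * (expR 6^-1)^-1 :> R.
      by rewrite ler_pM2l.
    by rewrite mulfV ?gt_eqF //; lra.
  have -> : (1 : R) = 6%:R * 6^-1 by lra.
  rewrite expRM_natl; apply: (@le_trans _ _ ((6 / 5) ^+ 6)); last by lra.
  by apply: lerXn2r; rewrite ?nnegrE ?expR_ge0 //; lra.
rewrite -ler_pdivrMr ?ltr0n ?fact_gt0 //.
apply: (@le_trans _ _ (expR m.+1%:R)).
  by apply: le_trans (expR_ge1Dxn m _); rewrite // lerDr.
rewrite -[m.+1%:R]mulr1 expRM_natl.
by apply: lerXn2r; rewrite ?nnegrE ?expR_ge0.
Qed.

Section Bounds.
Variables (R : realType) (N : nat) (B : 'M[R]_N).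
Implicit Types (I J : multi_index N).
Hypothesis B_ge0 : forall p q, 0 <= B p q.

Lemma wsum_monomial m (z : 'I_N -> R) :
  wsum B m (fun J => \prod_n z n ^+ J n) =
  (\sum_p \sum_q B p q * z p * z q) ^+ m.
Proof.
have prodU J p : \prod_n z n ^+ madd J (munit p) n = (\prod_n z n ^+ J n) * z p.
  rewrite (bigD1 p) //= [in RHS](bigD1 p) //= !ffunE eqxx exprD expr1 mulrAC.
  congr (_ * _ * _); apply: eq_bigr => k /negPf kp.
  by rewrite !ffunE kp addn0.
elim: m => [|m IH].
  by rewrite expr0 /wsum big1 // => n _; rewrite ffunE expr0.
rewrite wsumS exprS mulr_suml; apply: eq_bigr => p _.
rewrite mulr_suml; apply: eq_bigr => q _.
rewrite -!mulrA; congr (_ * _); rewrite -IH mulrA -wsumZ.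
by apply: eq_wsum => J; rewrite maddA !prodU; ring.
Qed.

(** All coefficients are nonnegative, so one monomial is at most the whole polynomial. *)
Lemma wsum_coef_le m I (z : 'I_N -> R) : (forall n, 0 <= z n) ->
  wsum B m (fun J => (J == I)%:R) * \prod_n z n ^+ I n <=
  (\sum_p \sum_q B p q * z p * z q) ^+ m.
Proof.
move=> z0; rewrite -wsum_monomial mulrC -wsumZ; apply: le_wsum => // J.
have [->|_] := eqVneq J I; first by rewrite mulr1.
by rewrite mulr0; apply: prodr_ge0 => n _; rewrite exprn_ge0.
Qed.

(* The choice z_n = sqrt (I n) is the saddle point of exp (r |z|^2 / 2) / z^I. *)
Lemma nhaf_sqr_le m I (r : R) : 0 <= r ->
  (forall z : 'I_N -> R, \sum_p \sum_q B p q * z p * z q <= r * \sum_n z n ^+ 2) ->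
  mweight I = m.*2 ->
  nhaf B m I ^+ 2 <= 2 ^+ N * (mfact I)%:R * (3 / 2 * r) ^+ m.*2.
Proof.
move=> r0 Br wI; pose z n : R := Num.sqrt (I n)%:R.
have z2 n : z n ^+ 2 = (I n)%:R by rewrite sqr_sqrtr.
set w := wsum B m (fun J => (J == I)%:R).
have w0 : 0 <= w.
  have -> : 0 = wsum B m (fun J => 0 * 0) by rewrite wsumZ mul0r.
  by apply: le_wsum => // J; rewrite mul0r.
pose P : R := \prod_n (I n)%:R ^+ I n.
have P0 : 0 <= P by apply: prodr_ge0 => n _; rewrite exprn_ge0.
(* At this z, |z|^2 = |I| = 2m, and P is the square of z^I. *)
have wP : w ^+ 2 * P <= (r * m.*2%:R) ^+ m.*2.
  have -> : P = (\prod_n z n ^+ I n) ^+ 2.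
    by rewrite -prodrXl; apply: eq_bigr => n _; rewrite exprAC z2.
  rewrite -exprMn -muln2 exprM; apply: lerXn2r; rewrite ?nnegrE.
  - by rewrite mulr_ge0 // prodr_ge0 // => n _; rewrite exprn_ge0 ?sqrtr_ge0.
  - by rewrite exprn_ge0 // mulr_ge0.
  apply: le_trans (wsum_coef_le m I (z := z) _) _ => [n|]; first exact: sqrtr_ge0.
  apply: lerXn2r; rewrite ?nnegrE ?mulr_ge0 //.
    by apply: sumr_ge0 => p _; apply: sumr_ge0 => q _; rewrite !mulr_ge0 ?sqrtr_ge0.
  apply: le_trans (Br z) _; rewrite ler_wpM2l // muln2 -wI /mweight natr_sum.
  by apply: ler_sum => n _; rewrite z2.
have FP : (mfact I)%:R * 2 ^+ m.*2 <= 2 ^+ N * P.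
  rewrite -wI /mweight /mfact natr_prod expr_sum -big_split /=.
  rewrite -[X in _ ^+ X]card_ord -prodr_const -big_split /=.
  apply: ler_prod => n _; rewrite mulr_ge0 ?exprn_ge0 //=.
  by rewrite -!natrX -!natrM ler_nat fact_exp2_le.
have mm := exp_le_fact3 R m.
rewrite /nhaf /hf -/w natrM natrX.
set F : R := (mfact I)%:R in FP *; set D : R := m`!%:R in mm *.
have D0 : 0 < D by rewrite ltr0n fact_gt0.
have F0 : 0 < F by rewrite ltr0n mfact_gt0.
have T0 k : 0 < 2 ^+ k :> R by rewrite exprn_gt0.
(* The 2^(2m) gained in [FP] cancels that in (2m)^(2m), and m^m <= 3^m m! prepares the cancellation
   of the (m!)^2 in the normalisation. *)
have step : F * w ^+ 2 <= 2 ^+ N * (r ^+ m.*2 * (3 ^+ m * D) ^+ 2).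
  have : F * w ^+ 2 * 2 ^+ m.*2 <= 2 ^+ N * (r * m.*2%:R) ^+ m.*2.
    rewrite mulrAC; apply: (@le_trans _ _ (2 ^+ N * P * w ^+ 2)).
      by rewrite ler_wpM2r ?sqr_ge0.
    by rewrite -mulrA ler_pM2l // mulrC.
  have -> : (r * m.*2%:R) ^+ m.*2 = (r * m%:R) ^+ m.*2 * 2 ^+ m.*2.
    by rewrite -exprMn -muln2 natrM mulrA.
  rewrite mulrA ler_pM2r // => /le_trans; apply.
  rewrite ler_pM2l // exprMn; apply: ler_wpM2l; first by rewrite exprn_ge0.
  rewrite -muln2 exprM; apply: lerXn2r; rewrite ?nnegrE ?exprn_ge0 //.
  by rewrite mulr_ge0 ?exprn_ge0 // ltW.
have -> : (F * w / (D * 2 ^+ m)) ^+ 2 = F * (F * w ^+ 2) / (D ^+ 2 * 2 ^+ m.*2).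
  by rewrite -muln2 exprM; field; rewrite -/D !gt_eqF.

have split2 : 2 ^+ N * F * (3 / 2 * r) ^+ m.*2 * (D ^+ 2 * 2 ^+ m.*2) =
    F * (2 ^+ N * (r ^+ m.*2 * (3 ^+ m * D) ^+ 2)).
  by rewrite !exprMn exprVn -!exprM muln2; field; rewrite gt_eqF //.
by rewrite ler_pdivrMr ?split2 ?ler_pM2l // mulr_gt0 ?exprn_gt0.
Qed.

(** Each coordinate loses a factor 3 in [odd_prod_ge], hence 3^N. *)
Lemma nhaf_double_ge I (x : R) : B^T = B -> 0 <= x -> (forall n, x <= B n n) ->
  (mfact I)%:R * (7 / 4 * x) ^+ mweight I <= 3 ^+ N * nhaf B (mweight I) (madd I I).
Proof.
move=> BT x0 xB; apply: le_trans (ler_wpM2l _ (nhaf_square_ge BT B_ge0 I)); last first.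
  by rewrite exprn_ge0.
rewrite /mweight /mfact natr_prod expr_sum -big_split /=.
rewrite -[X in _ ^+ X]card_ord -prodr_const -big_split /=.
apply: ler_prod => n _; rewrite mulr_ge0 ?exprn_ge0 ?mulr_ge0 //=.
apply: (@le_trans _ _ (3 * (x ^+ I n * (\prod_(j < I n) j.*2.+1)%:R))); last first.
  rewrite ler_wpM2l // ler_wpM2r //; apply: lerXn2r; rewrite ?nnegrE //.
have xi : 0 <= x ^+ I n by rewrite exprn_ge0.
rewrite !exprMn exprVn (mulrC _ (x ^+ _)) !(mulrCA _ (x ^+ _)) ler_wpM2l //.
rewrite mulrA ler_pdivrMr ?exprn_gt0 // -!natrX -!natrM ler_nat.
exact: odd_prod_ge.
Qed.

End Bounds.

(** * Matrices close to a multiple of the identity *)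

(* Crude: there are at most N distinct eigenvalues, each of multiplicity at
   most N. *)
Lemma dGBS_ge (R : realType) N (B : 'M[R]_N) (s : R) : 0 <= s <= 1 ->
  (forall l, eigenvalue B l -> s <= Num.sqrt (1 - l ^+ 2)) ->
  s ^+ (N * N) <= dGBS B.
Proof.
move=> /andP[s0 s1] sB.
have p0 : char_poly B != 0 by rewrite monic_neq0 ?char_poly_monic.
(* The product runs over the support of its factors, or is empty by default; an arbitrary list of
   distinct eigenvalues covers both cases. *)
suff prod_ge (X : seq R) : uniq X -> (forall l, l \in X -> eigenvalue B l) ->
    s ^+ (N * N) <= \prod_(l <- X) Num.sqrt (1 - l ^+ 2) ^+ mup l (char_poly B).
  rewrite /dGBS; case: finite_supportP => [_|X XP _ _]; first exact: prod_ge.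
  by apply: prod_ge => [|l lX]; [exact: fset_uniq | exact: (XP l)].
move=> uX XP.
have szX : (size X <= N)%N.
  rewrite -ltnS -(size_char_poly B); apply: max_poly_roots => //.
  by apply/allP => l lX; rewrite -eigenvalue_root_char; exact: (XP l).
apply: (@le_trans _ _ (\prod_(l <- X) s ^+ N)).
  rewrite big_const_seq count_predT iter_mulr_1 -exprM.
  by apply: ler_wiXn2l => //; rewrite leq_mul2l szX orbT.
rewrite [leRHS]big_seq [leLHS]big_seq; apply: ler_prod => l lX.
rewrite exprn_ge0 //=.
have sl := sB l (XP l lX).
have mupN : (mup l (char_poly B) <= N)%N.
  rewrite mup_leq //; apply/negP => /dvdp_leq-/(_ p0).
  by rewrite size_exp_XsubC size_char_poly ltnn.
apply: (@le_trans _ _ (s ^+ mup l (char_poly B))); first exact: ler_wiXn2l.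
by apply: lerXn2r; rewrite ?nnegrE // sqrtr_ge0.
Qed.

Section Neighbourhood.
Variables (R : realType) (N : nat).

(* The radius of [near_center] is also the off-diagonal entry of its center, so
   entries stay positive and those off the diagonal are at most 1 / (20 N). *)
Definition mx_gap : R := (40 * N%:R)^-1.

Definition center_matrix : 'M[R]_N := \matrix_(i, j) (17 / 20 * (i == j)%:R + mx_gap).

Definition near_center : set 'M[R]_N :=
  [set B | forall i j, `|center_matrix i j - B i j| < mx_gap].

Hypothesis N_gt0 : (0 < N)%N.

Lemma gap_gt0 : 0 < mx_gap.
Proof. by rewrite invr_gt0 mulr_gt0 // ltr0n. Qed.

Lemma gapN : mx_gap * N%:R = 40^-1.
Proof. by rewrite /mx_gap; field; rewrite pnatr_eq0 -lt0n. Qed.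

Lemma center_near : near_center center_matrix.
Proof. by move=> i j; rewrite subrr normr0 gap_gt0. Qed.

Lemma near_center_ge0 B p q : near_center B -> 0 <= B p q.
Proof.
move=> /(_ p q); rewrite mxE ltr_norml => /andP[_].
by have := gap_gt0; case: (p == q) => /=; lra.
Qed.

Lemma near_center_diag B p : near_center B -> 17 / 20 <= B p p.
Proof. by move=> /(_ p p); rewrite mxE eqxx ltr_norml => /andP[_] /=; lra. Qed.

(** Entrywise, B_pq <= 17/20 [p = q] + 2 [mx_gap] and z_p z_q <= (z_p^2 + z_q^2) / 2; summing gives
    17/20 + 2 N [mx_gap] = 9/10. *)
Lemma near_center_quad B (z : 'I_N -> R) : near_center B ->
  \sum_p \sum_q B p q * z p * z q <= 9 / 10 * \sum_n z n ^+ 2.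
Proof.
move=> nB; set S := \sum_n z n ^+ 2.
have Sp : \sum_p \sum_q (17 / 20 * (p == q)%:R + 2 * mx_gap) *
    ((z p ^+ 2 + z q ^+ 2) / 2) = 9 / 10 * S.
  have -> : 9 / 10 * S = 17 / 20 * S + 2 * mx_gap * N%:R * S.
    by rewrite -(mulrA 2) gapN; lra.
  transitivity (\sum_p (17 / 20 * z p ^+ 2 + mx_gap * (N%:R * z p ^+ 2 + S))).
    apply: eq_bigr => p _; under eq_bigr do rewrite mulrDl.
    rewrite big_split /=; congr (_ + _).
      rewrite (bigD1 p) //= [X in _ + X]big1 => [|q qp]; first by rewrite eqxx /=; lra.
      by rewrite eq_sym (negPf qp) mulr0 mul0r.
    rewrite -mulr_sumr -mulr_suml big_split /= sumr_const card_ord -(mulr_natl (z p ^+ 2)) -/S.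
    by field.
  rewrite big_split /= -!mulr_sumr -/S; congr (_ + _).
  rewrite big_split /= -mulr_sumr sumr_const card_ord -(mulr_natl S) -/S; ring.
rewrite -Sp; apply: ler_sum => p _; apply: ler_sum => q _.
have B0 := near_center_ge0 p q nB.
apply: (@le_trans _ _ (B p q * ((z p ^+ 2 + z q ^+ 2) / 2))).
  rewrite -mulrA ler_wpM2l //.
  by have := sqr_ge0 (z p - z q); rewrite sqrrB; lra.
apply: ler_wpM2r.
  by rewrite divr_ge0 // addr_ge0 ?sqr_ge0.
by have := nB p q; rewrite mxE ltr_norml => /andP[+ _]; lra.
Qed.

Lemma eigenvalue_quad (B : 'M[R]_N) l : eigenvalue B l ->
  exists2 v : 'I_N -> R, 0 < \sum_n v n ^+ 2 &
    \sum_p \sum_q B p q * v p * v q = l * \sum_n v n ^+ 2.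
Proof.
move=> /eigenvalueP[v vB v0]; exists (v 0) => /=.
  have [k vk] : exists k, v 0 k != 0.
    apply/existsP; rewrite -negb_forall; apply: contra v0 => /forallP v0.
    by apply/eqP/rowP => k; rewrite mxE; apply/eqP.
  rewrite (bigD1 k) //= ltr_pwDl ?sumr_ge0 // => [|i _]; last exact: sqr_ge0.
  by rewrite exprn_even_gt0.
rewrite exchange_big mulr_sumr; apply: eq_bigr => q _ /=.
have /(congr1 (fun u : 'rV_N => u 0 q)) := vB; rewrite !mxE => vBq.
rewrite expr2 mulrA -vBq mulr_suml; apply: eq_bigr => p _; ring.
Qed.

Lemma near_center_eigenvalue B l : near_center B -> eigenvalue B l -> l <= 9 / 10.
Proof.
move=> nB /eigenvalue_quad[v v0 vB]; have := near_center_quad v nB.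
by rewrite vB ler_pM2r.
Qed.

Lemma center_calB : calB center_matrix.
Proof.
split=> [|i j|l el].
- by apply/matrixP => i j; rewrite !mxE eq_sym.
- by rewrite mxE ltr_wpDl ?gap_gt0 // mulr_ge0.
- apply/andP; split; last first.
    by have := near_center_eigenvalue center_near el; lra.
  have [v v0] := eigenvalue_quad el.
  (* The constant part of the matrix contributes a perfect square, so the form is positive
     definite. *)
  have -> : \sum_p \sum_q center_matrix p q * v p * v q =
      17 / 20 * \sum_n v n ^+ 2 + mx_gap * (\sum_n v n) ^+ 2.
    rewrite expr2 mulr_suml !mulr_sumr -big_split /=; apply: eq_bigr => p _.
    under eq_bigr do rewrite mxE -mulrA mulrDl.
    rewrite big_split /=; congr (_ + _).
      rewrite (bigD1 p) //= [X in _ + X]big1 => [|q qp].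
        by rewrite eqxx expr2 /= mulr1 addr0.
      by rewrite eq_sym (negPf qp) mulr0 mul0r.
    by rewrite -mulr_sumr -mulr_sumr.
  move=> E; rewrite -(pmulr_lgt0 _ v0) -E.
  rewrite ltr_pwDl // ?mulr_gt0 // mulr_ge0 ?sqr_ge0 //; exact/ltW/gap_gt0.
Qed.

Lemma near_center_dGBS B : near_center B -> calB B ->
  (1 / 10) ^+ (N * N) <= dGBS B.
Proof.
move=> nB [_ _ eB]; apply: dGBS_ge => [|l el]; first by lra.
have l9 := near_center_eigenvalue nB el; have /andP[l0 _] := eB l el.
(* For 0 < l <= 9/10, 1 - l^2 >= 19/100 >= (1/10)^2. *)
rewrite -[1 / 10]ger0_norm ?divr_ge0 // -sqrtr_sqr ler_wsqrtr // !expr2; nra.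
Qed.

(* Exponential separation: rho and sig below are the growth rates 3/2 * r and
   7/4 * x of [nhaf_sqr_le] and [nhaf_double_ge] at r = 9/10 and x = 17/20, and
   1 <= rho < sig. *)
Lemma diagonal_gap (c D : R) : 0 < c -> 0 <= D -> exists m0 : nat, forall m B I,
  near_center B -> B^T = B -> (m0 <= m)%N -> mweight I = m.*2 ->
  D * ((mfact I)%:R * nhaf B m I ^+ 2) + 1 <=
  c * (nhaf B m.*2 (madd I I) ^+ 2 - (nhaf B m I ^+ 2) ^+ 2).
Proof.
move=> c0 D0.
pose rho : R := 27 / 20; pose sig : R := 119 / 80.
(* D + 1 + c and 4^N come from the bound (D + 1 + c) G below; 9^N is the square of the loss 3^N in
   the lower bound on H. *)
pose A : R := (D + 1 + c) * 4 ^+ N * 9 ^+ N.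
have A0 : 0 < A by rewrite !mulr_gt0 ?exprn_gt0 //; lra.
(* Since sig / rho = 119/108 >= 11/10, Bernoulli's inequality bounds the power below by 1 + 4m/10,
   so m0 >= 10 A / c suffices. *)
have [m0 Am0] : exists m0 : nat, forall m, (m0 <= m)%N -> A <= c * (sig / rho) ^+ (4 * m).
  have [m0 Am] : exists m0 : nat, A / c * 10 <= m0%:R.
    exists (Num.truncn (A / c * 10)).+1; apply: ltW; exact: truncnS_gt.
  exists m0 => m mm; rewrite mulrC -ler_pdivrMr //.
  have : 1 + 10^-1 * (4 * m)%:R <= (1 + 10^-1 : R) ^+ (4 * m).
    elim: (4 * m)%N => [|k IH]; first by rewrite mulr0 addr0 expr0.
    rewrite exprS -[k.+1%:R]natr1; move: IH; move: (_ ^+ k) (k%:R : R) (ler0n R k) => x y.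
    by lra.
  have : (1 + 10^-1) ^+ (4 * m) <= (sig / rho) ^+ (4 * m).
    by apply: lerXn2r; rewrite ?nnegrE /sig /rho; lra.
  have : m0%:R <= m%:R :> R by rewrite ler_nat.
  have : (0 : R) <= m%:R by [].
  rewrite natrM; move: (_ ^+ _) (_ ^+ _) => x y; lra.
exists m0 => m B I nB BT mm Im.
have B0 p q := near_center_ge0 p q nB.
have up := nhaf_sqr_le B0 (r := 9 / 10) _ (fun z => near_center_quad z nB) Im.
have {}up := up ltac:(lra).
have lo := nhaf_double_ge B0 I (x := 17 / 20) BT _ (fun n => near_center_diag n nB).
have {}lo := lo ltac:(lra).
rewrite Im in lo.
set h := nhaf B m I ^+ 2 in up *; set H := nhaf B m.*2 _ in lo *.
set F : R := (mfact I)%:R in up lo *.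
have F1 : 1 <= F by rewrite ler1n mfact_gt0.
have h0 : 0 <= h by rewrite sqr_ge0.
clearbody h H F.
have eup : 3 / 2 * (9 / 10) = rho by rewrite /rho; lra.
have elo : 7 / 4 * (17 / 20) = sig by rewrite /sig; lra.
rewrite eup in up; rewrite elo in lo.
have rho1 : 1 <= rho by rewrite /rho; lra.
have sig0 : 0 <= sig by rewrite /sig; lra.
have {}Am0 := Am0 m mm; clearbody rho sig.
have rho0 : 0 < rho by apply: lt_le_trans rho1.
have r1 k : 1 <= rho ^+ k by rewrite exprn_ege1.
have N1 : 1 <= 2 ^+ N :> R by rewrite exprn_ege1 //; lra.
have H2 : F ^+ 2 * sig ^+ (4 * m) <= 9 ^+ N * H ^+ 2.
  have -> : 9 ^+ N * H ^+ 2 = (3 ^+ N * H) ^+ 2.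
    by rewrite exprMn -exprM mulnC exprM; congr (_ ^+ _ * _); ring.
  have -> : F ^+ 2 * sig ^+ (4 * m) = (F * sig ^+ m.*2) ^+ 2.
    by rewrite exprMn -exprM; congr (_ * _ ^+ _); lia.
  have l0 : 0 <= F * sig ^+ m.*2 by rewrite mulr_ge0 ?exprn_ge0 // (le_trans ler01).
  by apply: lerXn2r; rewrite ?nnegrE //; apply: le_trans lo.
have rsq : rho ^+ (4 * m) = rho ^+ m.*2 * rho ^+ m.*2.
  by rewrite -exprD; congr (_ ^+ _); lia.
(* One majorant for the three quantities F h, h^2 and 1. *)
pose G := 4 ^+ N * F ^+ 2 * rho ^+ (4 * m).
have h2G : h ^+ 2 <= G.
  have -> : G = (2 ^+ N * F * rho ^+ m.*2) ^+ 2.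
    rewrite /G rsq !exprMn -(exprM 2) mulnC (exprM 2) expr2 [X in _ = _ * X]expr2.
    by congr (_ ^+ _ * _ * _); ring.
  by apply: lerXn2r; rewrite ?nnegrE // !mulr_ge0 ?exprn_ge0 // ?(le_trans ler01) // ltW.
have hG : F * h <= G.
  apply: (@le_trans _ _ (F * (2 ^+ N * F * rho ^+ m.*2))).
    by rewrite ler_pM2l // (lt_le_trans ltr01).
  have -> : G = F * (2 ^+ N * F * rho ^+ m.*2) * (2 ^+ N * rho ^+ m.*2).
    rewrite /G rsq (_ : 4 = 2 * 2); last by ring.
    by rewrite exprMn; ring.
  rewrite ler_peMr ?mulr_ege1 //.
  by rewrite !mulr_ge0 // (le_trans ler01).
have G1 : 1 <= G.
  by rewrite /G !mulr_ege1 // exprn_ege1 //; lra.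
have key : (D + 1 + c) * G <= c * H ^+ 2.
  have : A * (F ^+ 2 * rho ^+ (4 * m)) <=
      c * (sig / rho) ^+ (4 * m) * (F ^+ 2 * rho ^+ (4 * m)).
    by rewrite ler_wpM2r // mulr_ge0 // (le_trans ler01) // exprn_ege1.
  have -> : c * (sig / rho) ^+ (4 * m) * (F ^+ 2 * rho ^+ (4 * m)) =
      c * (F ^+ 2 * sig ^+ (4 * m)).
    have : rho ^+ (4 * m) != 0 by rewrite expf_neq0 // gt_eqF.
    by rewrite expr_div_n; move: (sig ^+ _) (rho ^+ _) => a b b0; field.
  move=> /le_trans/(_ (ler_wpM2l (ltW c0) H2)).
  have -> : A * (F ^+ 2 * rho ^+ (4 * m)) = 9 ^+ N * ((D + 1 + c) * G).
    by rewrite /A /G; ring.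
  by rewrite (mulrCA c) ler_pM2l // exprn_gt0.
rewrite mulrBr lerBrDr; apply: le_trans key.
rewrite !mulrDl mul1r; apply: lerD; last by rewrite ler_pM2l.
by apply: lerD; rewrite ?ler_wpM2l.
Qed.

End Neighbourhood.

(** * Sums over pairs *)

Section Esum.
Variables (R : realType) (T : choiceType).
Local Open Scope ereal_scope.

Lemma esumZl (k : R) (f : T -> \bar R) : (0 <= k)%R -> (forall x, 0 <= f x) ->
  \esum_(x in [set: T]) (k%:E * f x) = k%:E * (\esum_(x in [set: T]) f x).
Proof.
move=> k0 f0.
(* This inequality, applied again to the inverse scalar, gives the converse. *)
have le_esumZl (a : R) (g : T -> \bar R) : (0 <= a)%R -> (forall x, 0 <= g x) ->
    \esum_(x in [set: T]) (a%:E * g x) <= a%:E * (\esum_(x in [set: T]) g x).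
  move=> a0 g0; apply: ge_ereal_sup => _ [X XT <-].
  rewrite -ge0_mule_fsumr //; apply: lee_wpmul2l; first by rewrite lee_fin.
  by apply: ereal_sup_ubound; exists X.
apply/eqP; rewrite eq_le le_esumZl //=.
have [->|kn0] := eqVneq k 0%R.
  by rewrite mul0e; apply: esum_ge0 => x _; rewrite mul0e.
have kp : (0 < k)%R by rewrite lt_def kn0.
rewrite -lee_pdivlMl //; apply: le_trans (le_esumZl _ _ _ _) => [|| x].
- by apply: le_esum => x _; rewrite muleA -EFinM mulVf // mul1e.
- by rewrite invr_ge0.
- by rewrite mule_ge0 ?lee_fin.
Qed.

Lemma esum_sub (T' : choiceType) (e : T' -> T) (f : T -> \bar R) :
  injective e -> (forall x, 0 <= f x) ->
  \esum_(y in [set: T']) f (e y) <= \esum_(x in [set: T]) f x.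
Proof.
move=> inj_e f0; rewrite -(esum_image [set: T'] e f); last by move=> x y _ _; exact: inj_e.
by rewrite esum_mkcond; apply: le_esum => x _; case: ifP.
Qed.

Lemma esum_eq1 (x0 : T) (f : T -> \bar R) : 0 <= f x0 ->
  (forall x, x != x0 -> f x = 0) -> \esum_(x in [set: T]) f x = f x0.
Proof.
move=> f0 fx; rewrite -(esum_set1 f0) [RHS]esum_mkcond; apply: eq_esum => x _.
by rewrite in_set1; case: eqVneq => // /fx.
Qed.

End Esum.

(** * Comparison of a single sum with the diagonal of a double sum *)

Section PairGap.
Variables (R : realType) (T : choiceType) (t b : T -> R) (q : T * T -> R).
Variables (c : R) (S : set T) (x0 : T).
Hypotheses (c_ge0 : 0 <= c) (t_ge0 : forall x, 0 <= t x) (b_ge0 : forall x, 0 <= b x).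
Hypothesis q_ge : forall x y, b x * b y <= q (x, y).
Hypothesis q_diag : forall x, ~ S x ->
  t x + (x == x0)%:R <= c * (q (x, x) - b x * b x).
Hypothesis x0S : ~ S x0.
Hypothesis tS : (\esum_(x in S) (t x)%:E <= 1)%E.
Hypothesis b_fin : (\esum_(x in [set: T]) (b x)%:E < +oo)%E.
Local Open Scope ereal_scope.

(** Here t, b and q stand for the terms of Q^GBS, mu and Q^MC. Off the diagonal only nonnegativity
    of q - b b is used; on it, each x outside S pays for its own t, and x0 pays 1 more for all of
    S. *)
Lemma esum_pair_gap :
  \esum_(x in [set: T]) (t x)%:E + c%:E * (\esum_(x in [set: T]) (b x)%:E) ^+ 2
  <= c%:E * (\esum_(p in [set: T * T]) (q p)%:E).
Proof.
pose g p : R := (q p - b p.1 * b p.2)%R.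
have g0 p : (0 <= g p)%R by case: p => x y; rewrite subr_ge0 q_ge.
have qE : \esum_(p in [set: T * T]) (q p)%:E =
    \esum_(p in [set: T * T]) (g p)%:E + (\esum_(x in [set: T]) (b x)%:E) ^+ 2.
  have -> : (\esum_(x in [set: T]) (b x)%:E) ^+ 2 =
      \esum_(p in [set: T * T]) ((b p.1)%:E * (b p.2)%:E).
    have -> : [set: T * T] = [set: T] `*`` (fun=> [set: T]).
      by apply/seteqP; split=> [[x y]|].
    rewrite -(@esum_esum _ _ _ [set: T] (fun=> [set: T])
      (fun x y => (b x)%:E * (b y)%:E)); last first.
      by move=> x y _ _; rewrite mule_ge0 ?lee_fin.
    under [RHS]eq_esum => x _.
      rewrite (_ : esum _ _ = (b x)%:E * (\esum_(y in [set: T]) (b y)%:E)); first over.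
      by apply: esumZl => // y; rewrite lee_fin.
    have [M ME] : exists M : R, \esum_(x in [set: T]) (b x)%:E = M%:E.
      exists (fine (\esum_(x in [set: T]) (b x)%:E)); rewrite fineK //.
      by rewrite ge0_fin_numE // esum_ge0 // => x _; rewrite lee_fin.
    have M0 : (0 <= M)%R by rewrite -lee_fin -ME esum_ge0 // => x _; rewrite lee_fin.
    rewrite ME expe2 -{2}ME -esumZl //.
    by apply: eq_esum => x _; rewrite muleC.
  rewrite -esumD => [||p _]; last by rewrite mule_ge0 ?lee_fin.
    by apply: eq_esum => p _; rewrite -EFinM -EFinD subrK.
  by move=> p _; rewrite lee_fin.
rewrite qE ge0_muleDr; first last.
- by rewrite expe2 mule_ge0 // esum_ge0 // => x _; rewrite lee_fin.
- by rewrite esum_ge0 // => x _; rewrite lee_fin.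
apply: leeD2r.
(* The sum of t is not known to be finite here, so the surplus is kept as the number 1, which can be
   cancelled. *)
have diag : \esum_(x in [set: T]) (t x)%:E + 1 <= c%:E * (\esum_(p in [set: T * T]) (g p)%:E) + 1.
  apply: (@le_trans _ _ (\esum_(x in [set: T]) (t x + (x == x0)%:R)%:E)).
    under [leRHS]eq_esum do rewrite EFinD.
    rewrite esumD; try by move=> x _; rewrite lee_fin.
    by rewrite (@esum_eq1 _ _ x0 (fun x => ((x == x0)%:R)%:E)) ?eqxx // => x /negPf->.
  apply: (@le_trans _ _ (\esum_(x in [set: T])
      (c%:E * (g (x, x))%:E + if x \in S then (t x)%:E else 0))).
    apply: le_esum => x _; case: ifPn => [/set_mem xS|xS].
      have -> : (x == x0) = false by apply/eqP => xx0; apply: x0S; rewrite -xx0.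
      by rewrite addr0 leeDr // mule_ge0 ?lee_fin.
    by rewrite adde0 -EFinM lee_fin q_diag // => /mem_set; apply/negP.
  rewrite esumD; first last.
  - by move=> x _; case: ifP => _; rewrite ?lee_fin.
  - by move=> x _; rewrite mule_ge0 ?lee_fin.
  rewrite -(esum_mkcond S (fun x => (t x)%:E)) leeD //.
  rewrite (esumZl (f := fun x => (g (x, x))%:E)) // => [|x]; last by rewrite lee_fin.
  apply: lee_wpmul2l; rewrite ?lee_fin //.
  apply: (esum_sub (e := fun x => (x, x)) (f := fun p => (g p)%:E)).
    by move=> x y [].
  by move=> p; rewrite lee_fin.
by rewrite leeD2rE in diag.
Qed.
End PairGap.

(** * The open set *)

(** The M^2 subtracted on the left is dropped: G - M^2 <= G <= c (Q - M^2). *)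
Lemma sample_size_le (R : realType) (G Q M c eps delta : R) :
  0 < M -> 0 < eps -> 0 < delta -> G + c * M ^+ 2 <= c * Q ->
  (sample_size G%:E M%:E eps delta <= c%:E * sample_size Q%:E M%:E eps delta < +oo)%E.
Proof.
move=> M0 e0 d0 GQ; have M2 : 0 < delta * eps ^+ 2 * M ^+ 2 by rewrite !mulr_gt0 ?exprn_gt0.
rewrite /sample_size -!EFin_expe -!EFinM -!EFinB inver gt_eqF // -!EFinM ltry andbT.
by rewrite lee_fin mulrA ler_pM2r ?invr_gt0 //; have := sqr_ge0 M; lra.
Qed.

Lemma near_center_open (R : realType) N : (0 < N)%N -> open (@near_center R N).
Proof.
move=> N0; have -> : @near_center R N = ball (center_matrix R N) (mx_gap R N);
  last exact: ball_open.
apply/seteqP; split=> B => [nB|[_ nB] i j].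
  by split=> [|i j]; [exact: gap_gt0 | rewrite -ball_normE; exact: nB].
by have := nB i j; rewrite -ball_normE.
Qed.

Lemma continuous_weighted_sqr (R : realType) (T : topologicalType) (X : Type)
    (s : seq X) (w : X -> R) (f : X -> T -> R) : (forall i, continuous (f i)) ->
  continuous (fun x => \sum_(i <- s) w i * f i x ^+ 2).
Proof.
move=> fc; elim: s => [|i s IH] x.
  by under eq_fun do rewrite big_nil; exact: cvg_cst.
under eq_fun do rewrite big_cons; apply: cvgD; last exact: IH.
by apply: cvgM; [exact: cvg_cst | apply: cvgM; exact: fc].
Qed.

Section CoeffTopology.
Variables (R : realType) (N : nat) (K : option nat).

Lemma coeff_proj_continuous (I : midx N K) :
  continuous (fun x : coeff R N K * 'M[R]_N => x.1 I).
Proof.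
move=> x; apply: (@continuous_comp _ _ _ fst (fun a : coeff R N K => a I)).
  exact: cvg_fst.
exact: (@proj_continuous _ (fun=> R) I).
Qed.

(** All entries of such an index are below k, so it comes from a function into ['I_k]. *)
Lemma finite_small_midx k : finite_set [set I : midx N K | (mweight (val I) < k)%N].
Proof.
pose f (u : {ffun 'I_N -> 'I_k}) : option (midx N K) :=
  insub ([ffun n => val (u n)] : multi_index N).
pose s := pmap f (enum {ffun 'I_N -> 'I_k}).
apply: (sub_finite_set (B := [set` s])); last exact: finite_seq.
move=> I /= Ik; rewrite mem_pmap; apply/mapP.
have In n : (val I n < k)%N.
  by apply: leq_ltn_trans Ik; rewrite /mweight (bigD1 n) //= leq_addr.
exists [ffun n => Ordinal (In n)]; first by rewrite mem_enum.
rewrite /f (_ : [ffun _ => _] = val I) ?valK //.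
by apply/ffunP => n; rewrite !ffunE.
Qed.

End CoeffTopology.

Lemma midx_double (N : nat) (K : option nat) (I : midx N K) :
  mweight (val I) = (mweight (val I))./2.*2.
Proof. by case: I => I /= /andP[I2 _]; rewrite even_halfK. Qed.

Section Region.
Variables (R : realType) (N : nat) (K : option nat) (m0 : nat) (I0 : midx N K).

Definition small_midx : set (midx N K) :=
  [set I | (mweight (val I) < m0.*2)%N].

Definition dGBS_inv_bound : R := ((1 / 10) ^+ (N * N))^-1.

(* A bound, uniform over [near_center], for the coefficient of a_I^2 in Q^GBS. *)
Definition small_weight (I : midx N K) : R :=
  dGBS_inv_bound * ((mfact (val I))%:R *
    (2 ^+ N * (mfact (val I))%:R * (27 / 20) ^+ mweight (val I))).

(** The bound 1 on the finite sum matches the surplus of at least 1 that [1 < x.1 I0] provides. *)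
Definition region_nbhs : set (coeff R N K * 'M[R]_N) :=
  [set x | [/\ near_center x.2, 1 < x.1 I0 &
    \sum_(I <- fset_set small_midx) small_weight I * x.1 I ^+ 2 < 1]].

Definition region := @problem_space R N K `&` region_nbhs.

Hypothesis N_gt0 : (0 < N)%N.

Lemma region_nbhs_open : open region_nbhs.
Proof.
have -> : region_nbhs = (snd @^-1` (@near_center R N)) `&`
    ((fun x : coeff R N K * 'M[R]_N => x.1 I0) @^-1` [set r | 1 < r]) `&`
    ((fun x : coeff R N K * 'M[R]_N => \sum_(I <- fset_set small_midx)
        small_weight I * x.1 I ^+ 2) @^-1` [set r | r < 1]).
  by apply/seteqP; split=> [x []|x [[]]].
apply: openI; first apply: openI; apply: open_comp.
- by move=> x _; exact: cvg_snd.
- exact: near_center_open.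
- by move=> x _; exact: coeff_proj_continuous.
- exact: open_gt.
- move=> x _; apply: continuous_weighted_sqr => I; exact: coeff_proj_continuous.
- exact: open_lt.
Qed.

Lemma region_open : open_in_problem_space region.
Proof.
split; first exact: subIsetl.
apply/open_subspaceP; exists region_nbhs; first exact: region_nbhs_open.
by rewrite /region setIAC setIid setIC.
Qed.

Variable c : R.
Hypothesis c_gt0 : 0 < c.
Hypothesis tail : forall m (B : 'M[R]_N) (I : multi_index N),
  near_center B -> B^T = B -> (m0 <= m)%N -> mweight I = m.*2 ->
  dGBS_inv_bound * ((mfact I)%:R * nhaf B m I ^+ 2) + 1 <=
  c * (nhaf B m.*2 (madd I I) ^+ 2 - (nhaf B m I ^+ 2) ^+ 2).
Hypothesis I0_large : ~ small_midx I0.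

Lemma region_QGBS_le a B : region (a, B) ->
  (QGBS a B + c%:E * mu a B ^+ 2 <= c%:E * QMC a B)%E.
Proof.
move=> [[/= BB [a0 [mu0 mufin GBSfin MCfin]]] [/= nB aI0 asmall]].
have [BT Bpos eB] := BB.
have B_ge0 p q : 0 <= B p q by rewrite ltW.
have dB := near_center_dGBS N_gt0 nB BB.
have d0 : 0 < dGBS B by apply: lt_le_trans dB; rewrite exprn_gt0 // divr_gt0.
have dinv : (dGBS B)^-1 <= dGBS_inv_bound.
  by rewrite lef_pV2 // posrE exprn_gt0 // divr_gt0.
have hE (I : midx N K) : hafI B (val I) = nhaf B (mweight (val I))./2 (val I).
  by apply: hafI_nhaf; exact: midx_double.
have HE (I J : midx N K) : hafI B (madd (val I) (val J)) =
    nhaf B ((mweight (val I))./2 + (mweight (val J))./2) (madd (val I) (val J)).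
  by apply: hafI_nhaf; rewrite mweightD doubleD -!midx_double.
pose t (I : midx N K) : R :=
  (dGBS B)^-1 * (a I ^+ 2 * (mfact (val I))%:R * hafI B (val I) ^+ 2).
pose b (I : midx N K) : R := a I * hafI B (val I) ^+ 2.
pose q (p : midx N K * midx N K) : R :=
  a p.1 * a p.2 * hafI B (madd (val p.1) (val p.2)) ^+ 2.
have d_ge0 : 0 <= (dGBS B)^-1 by rewrite invr_ge0 ltW.
have GBS_ge0 (I : midx N K) :
    0 <= a I ^+ 2 * (mfact (val I))%:R * hafI B (val I) ^+ 2.
  by rewrite mulr_ge0 ?sqr_ge0 // mulr_ge0 ?sqr_ge0.
have t_ge0 I : 0 <= t I by rewrite mulr_ge0.
have -> : QGBS a B = (\esum_(I in [set: midx N K]) (t I)%:E)%E.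
  by rewrite /QGBS /sumGBS -esumZl.
apply: (@esum_pair_gap _ _ t b q c small_midx I0) => //.
- exact: ltW.
- by move=> I; rewrite /b mulr_ge0 ?sqr_ge0 // a0.
- move=> I J; rewrite /b /q /= mulrACA ler_wpM2l ?mulr_ge0 ?a0 //.
  have nh0 m L := nhaf_ge0 BT B_ge0 m L.
  rewrite -exprMn HE !hE; apply: lerXn2r; rewrite ?nnegrE; first exact: mulr_ge0.
    exact: nh0.
  exact: nhaf_supmul.
- move=> I /negP; rewrite -leqNgt => Ilarge.
  set m := (mweight (val I))./2.
  have Im : mweight (val I) = m.*2 by exact: midx_double.
  have mm : (m0 <= m)%N by rewrite -leq_double -Im.
  have := tail nB BT mm Im.
  rewrite /t /b /q /= HE hE -/m addnn.
  set F := (mfact _)%:R; set h := nhaf B m _ ^+ 2; set H := nhaf B _ _.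
  have Fh : 0 <= F * h by rewrite mulr_ge0 ?sqr_ge0.
  clearbody F h => tl.
  (* Both sides of [tail] scale by a_I^2, so its summand 1 becomes a_I^2, which is at least 1 at I0
     and nonnegative elsewhere. *)
  have aI : (I == I0)%:R <= a I ^+ 2.
    case: eqVneq => [->|_] /=; last exact: sqr_ge0.
    by rewrite exprn_ege1 // ltW.
  have a2 := sqr_ge0 (a I).
  have factor x : c * (a I * a I * x ^+ 2 - a I * h * (a I * h)) =
    a I ^+ 2 * (c * (x ^+ 2 - h ^+ 2)) by ring.
  rewrite factor.
  have le1 : (dGBS B)^-1 * (a I ^+ 2 * F * h) + (I == I0)%:R <=
      a I ^+ 2 * (dGBS_inv_bound * (F * h) + 1).
    rewrite mulrDr mulr1 lerD //.
    by rewrite -mulrA mulrCA ler_wpM2l // ler_wpM2r.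
  exact: (le_trans le1 (ler_wpM2l a2 tl)).
- rewrite esum_fset; first last.
  + by move=> I _; rewrite lee_fin.
  + exact: finite_small_midx.
  rewrite fsbig_finite /=; last exact: finite_small_midx.
  rewrite sumEFin lee_fin; apply: le_trans (ltW asmall).
  apply: ler_sum => I _; rewrite /t /small_weight.
  have swap (x y z w : R) : x * (y * z * w) = x * (z * w) * y by ring.
  rewrite swap; apply: ler_wpM2r; first exact: sqr_ge0.
  apply: ler_pM => //; first by rewrite mulr_ge0 ?sqr_ge0.
  rewrite ler_wpM2l // hE.
  have := nhaf_sqr_le B_ge0 (r := 9 / 10) _ (fun z => near_center_quad N_gt0 z nB) (midx_double I).
  rewrite -midx_double (_ : 3 / 2 * (9 / 10) = 27 / 20); last by lra.
  by apply; lra.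
Qed.

Lemma region_sample_size a B eps delta : region (a, B) -> 0 < eps < 1 -> 0 < delta < 1 ->
  (nGBS a B eps delta <= c%:E * nMC a B eps delta < +oo)%E.
Proof.
move=> aB /andP[e0 _] /andP[d0 _]; have := region_QGBS_le aB.
case: aB => [[/= BB [a0 [mu0 mufin GBSfin MCfin]]] _].
have mu_ge0 : (0 <= mu a B)%E.
  by apply: esum_ge0 => I _; rewrite lee_fin mulr_ge0 ?sqr_ge0 // a0.
have G_ge0 : (0 <= sumGBS a B)%E.
  by apply: esum_ge0 => I _; rewrite lee_fin mulr_ge0 ?sqr_ge0 // mulr_ge0 ?sqr_ge0.
have Q_ge0 : (0 <= QMC a B)%E.
  by apply: esum_ge0 => p _; rewrite lee_fin mulr_ge0 ?sqr_ge0 // mulr_ge0 ?a0.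
rewrite /nGBS /nMC /QGBS.
move: (mu a B) (sumGBS a B) (QMC a B) mu0 mufin GBSfin MCfin mu_ge0 G_ge0 Q_ge0.
move=> [M||] [G||] [Q||] //= M0 _ _ _ M_ge0 _ _.
rewrite -!EFinM -EFinD lee_fin -expr2 => le.
apply: sample_size_le => //.
by rewrite lt_def -lee_fin M_ge0 andbT; move: M0; rewrite eqe.
Qed.

(** With only a_I0 nonzero, every sum reduces to one term; the form I0 = 2J makes [nhaf_double_ge]
    applicable, so mu is nonzero. *)
Lemma region_nonempty (J : multi_index N) : val I0 = madd J J -> region !=set0.
Proof.
move=> I0J; pose a : coeff R N K := fun I => if I == I0 then 2 else 0.
have aN I : I != I0 -> a I = 0 by rewrite /a => /negPf->.
have aI0 : a I0 = 2 by rewrite /a eqxx.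
have nB := @center_near R N N_gt0.
have B_ge0 p q : 0 <= center_matrix R N p q by exact: near_center_ge0.
have BB := @center_calB R N N_gt0; have [BT _ _] := BB.
have muE : mu a (center_matrix R N) = (2 * hafI (center_matrix R N) (val I0) ^+ 2)%:E.
  rewrite /mu (esum_eq1 (x0 := I0)) ?aI0 // => [|I /aN->]; last by rewrite mul0r.
  by rewrite lee_fin mulr_ge0 ?sqr_ge0.
have h0 : 0 < hafI (center_matrix R N) (val I0).
  rewrite I0J (@hafI_nhaf _ _ _ _ (mweight J)) ?mweightD ?addnn //.
  have := nhaf_double_ge B_ge0 J (x := 17 / 20) BT _ (fun n => near_center_diag n nB).
  move=> /(_ ltac:(lra)) le; rewrite -(pmulr_rgt0 _ (exprn_gt0 N (ltr0n _ 3))).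
  apply: lt_le_trans le; rewrite mulr_gt0 ?ltr0n ?mfact_gt0 // exprn_gt0 //; lra.
exists (a, center_matrix R N); split; split=> //=.
- split=> [I|]; first by rewrite /a; case: ifP.
  split.
  + by rewrite muE eqe gt_eqF // mulr_gt0 // exprn_gt0.
  + by rewrite muE ltry.
  + rewrite /sumGBS (esum_eq1 (x0 := I0)) ?ltry // => [|I /aN->].
      by rewrite lee_fin mulr_ge0 ?sqr_ge0 // mulr_ge0 ?sqr_ge0.
    by rewrite expr0n !mul0r.
  + rewrite /QMC (esum_eq1 (x0 := (I0, I0))) ?ltry // => [|[I I'] /=].
      by rewrite lee_fin /= aI0 mulr_ge0 ?sqr_ge0.
    rewrite xpair_eqE negb_and => /orP[] /aN->; by rewrite ?mulr0 !mul0r.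
- by rewrite aI0; lra.
- rewrite big_seq big1 // => I; rewrite in_fset_set; last exact: finite_small_midx.
  move=> /set_mem IS; rewrite aN ?expr0n ?mulr0 //.
  by apply/eqP => II0; apply: I0_large; rewrite -II0.
Qed.

End Region.

Theorem theorem1p4 (R : realType) (c : R) (c_gt0 : 0 < c)
    (N : nat) (N_gt0 : (0 < N)%N) :
  exists K0 : nat, forall K : option nat, atmostK K0 K ->
  exists U : set (coeff R N K * 'M[R]_N),
    [/\ open_in_problem_space U,
        U !=set0 &
        forall (a : coeff R N K) (B : 'M[R]_N), U (a, B) ->
        forall eps delta : R, 0 < eps < 1 -> 0 < delta < 1 ->
          (nGBS a B eps delta <= c%:E * nMC a B eps delta < +oo)%E].
Proof.
have D0 : 0 <= dGBS_inv_bound R N by rewrite invr_ge0 exprn_ge0 // divr_ge0.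
have [m0 tail] := diagonal_gap N_gt0 c_gt0 D0.
(* The threshold only ensures that an index of weight 2 m0 is admissible; J puts all its weight on
   the first coordinate and I0 = 2J. *)
exists m0 => K m0K.
pose J : multi_index N := [ffun k => if k == Ordinal N_gt0 then m0 else 0%N].
have wJ : mweight J = m0.
  rewrite /mweight (bigD1 (Ordinal N_gt0)) //= ffunE eqxx big1 ?addn0 // => k /negPf kn.
  by rewrite ffunE kn.
have adm : admissible K (madd J J).
  by rewrite /admissible mweightD wJ addnn odd_double doubleK.
pose I0 : midx N K := exist (fun I => admissible K I) (madd J J) adm.
have I0_large : ~ small_midx m0 I0 by rewrite /small_midx /= mweightD wJ addnn ltnn.
exists (@region R N K m0 I0); split.
- exact: region_open.
- exact: (@region_nonempty _ _ _ _ _ N_gt0 I0_large J).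
- move=> a B aB eps delta e01 d01.
  exact: (region_sample_size N_gt0 c_gt0 tail I0_large aB).
Qed.
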